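(* Let $Q$ be a finite nonempty set of primes with $2,3\notin Q$ and $|Q|\le 4$ such that $$3\cdot \prod_{q\in Q}(q-1) - 2\prod_{q\in Q} q = 2,$$ and let $n=\prod_{q\in Q}q$. Then $n\in\{5,\ 5\cdot 7,\ 5\cdot 7\cdot 37,\ 5\cdot 7\cdot 37\cdot 1297\}$, and each of these four values arises from such a set $Q$.
   Context: The solutions of the displayed equation, via $n=\prod_{q\in Q}q$, correspond exactly to the positive integers $n>1$ with $\phi(n)=\frac23(n+1)$ ($\phi$ Euler's totient). *)

(* Defs.v *)
From mathcomp Require Import all_boot all_order all_algebra.
From mathcomp Require Import finmap.

Set Implicit Arguments.
Unset Strict Implicit.
Unset Printing Implicit Defensive.

Import GRing.Theory Num.Theory.

Local Open Scope fset_scope.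
Local Open Scope ring_scope.

(* The equation is read in [int], so that the subtractions are genuine ones
   rather than the truncated ones of [nat]. *)
Definition admissible (Q : {fset nat}) : Prop :=
  [/\ Q != fset0,
      {in Q, forall q, prime q},
      2%N \notin Q /\ 3%N \notin Q,
      (#|` Q| <= 4)%N &
      3 * (\prod_(q <- Q) (q%:Z - 1)) - 2 * (\prod_(q <- Q) q%:Z) = 2 :> int].

(* Main.v *)
Require Import Defs.
From mathcomp Require Import all_boot all_order all_algebra.
From mathcomp Require Import finmap.
From mathcomp Require Import zify ring.

(** Divided by [n], the equation says that the product of the [1 - 1/q] slightly
    exceeds [2/3].  For at most four distinct primes that are all at least [7]
    this product is too large, so [Q] contains [5]; the same comparison bounds
    the next element.  Once all but two primes are fixed, the equation takes the
    form [(k * u - l) * (k * v - l) = m], which has finitely many solutions. *)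

Lemma prime_gt3_cases (p : nat) : prime p -> p != 2 -> p != 3 ->
  (p \in [:: 5; 7; 11; 13]) || (17 <= p).
Proof.
have [|lt17] := leqP 17 p; first by rewrite orbT.
by move: p lt17; do 17 case=> //.
Qed.

(** The equation factors as [(a - 3) * (b - 3) = 8], with [2 <= a - 3 < b - 3]. *)
Lemma two_primes_eq (a b : nat) : 5 <= a -> a < b ->
  3 * (a.-1 * b.-1) = 2 * (a * b) + 2 -> a = 5 /\ b = 7.
Proof.
move=> a5 ab e; have : a < 6 by nia.
by move=> a6; have ea : a = 5 by [lia]; subst a; lia.
Qed.

(** Bounds [1 - 1/a] below by [k/(k+1)], its value at the least [a] allowed; such bounds get
    multiplied factor by factor. *)
Lemma leq_mul_predn (k a : nat) : k < a -> k * a <= k.+1 * a.-1.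
Proof. by nia. Qed.

(** The worst case is [720/1001 > 2/3]; the lower bound [1001] on the product absorbs the [+ 2]. *)
Lemma three_primes_smallest (a b c : nat) :
  7 <= a -> 11 <= b -> 13 <= c ->
  2 * (a * (b * c)) + 2 < 3 * (a.-1 * (b.-1 * c.-1)).
Proof.
move=> a7 b11 c13.
have := leq_mul (leq_mul_predn _ _ a7)
  (leq_mul (leq_mul_predn _ _ b11) (leq_mul_predn _ _ c13)).
have := leq_mul a7 (leq_mul b11 c13).
lia.
Qed.

(** The margin is slim, [9360/14014] against [2/3]; the bound on [d] that comes from [13 <= c < d]
    is already enough. *)
Lemma four_primes_smallest (a b c d : nat) :
  7 <= a -> 11 <= b -> 13 <= c -> 14 <= d ->
  2 * (a * (b * (c * d))) + 2 < 3 * (a.-1 * (b.-1 * (c.-1 * d.-1))).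
Proof.
move=> a7 b11 c13 d14.
have := leq_mul (leq_mul_predn _ _ a7) (leq_mul (leq_mul_predn _ _ b11)
  (leq_mul (leq_mul_predn _ _ c13) (leq_mul_predn _ _ d14))).
have := leq_mul a7 (leq_mul b11 (leq_mul c13 d14)).
lia.
Qed.

(** Once 5 is split off, the target ratio is [5/6]; the bounds telescope to [16/19 > 5/6]. *)
Lemma three_primes_after5_smallest (b c d : nat) :
  17 <= b -> 18 <= c -> 19 <= d ->
  5 * (b * (c * d)) + 1 < 6 * (b.-1 * (c.-1 * d.-1)).
Proof.
move=> b17 c18 d19.
have := leq_mul (leq_mul_predn _ _ b17)
  (leq_mul (leq_mul_predn _ _ c18) (leq_mul_predn _ _ d19)).
have := leq_mul b17 (leq_mul c18 d19).
lia.
Qed.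

(** The equation is [(b - 6) * (c - 6) = 31], and 31 is prime. *)
Lemma two_primes_after5_eq (b c : nat) : 7 <= b -> b < c ->
  6 * (b.-1 * c.-1) = 5 * (b * c) + 1 -> b = 7 /\ c = 37.
Proof.
move=> b7 bc e; have b12 : b < 12 by nia.
have : b \in iota 7 5 by rewrite mem_iota; lia.
by rewrite !inE; do ![case/orP]; move/eqP=> eb; subst b; lia.
Qed.

(** The equation is [(c - 36) * (d - 36) = 1261 = 13 * 97]; primality of [c] discards the other
    solution [c = 49], [d = 133]. *)
Lemma two_primes_after5_7_eq (c d : nat) : 7 < c -> c < d ->
  prime c -> 36 * (c.-1 * d.-1) = 35 * (c * d) + 1 -> c = 37 /\ d = 1297.
Proof.
move=> c7 cd pc e; have c37 : 36 < c.
  by rewrite ltnNge; apply/negP=> c36; nia.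
have c72 : c < 72 by nia.
have : c \in iota 37 35 by rewrite mem_iota; lia.
rewrite !inE; do ![case/orP]; move/eqP=> ec; subst c => //; lia.
Qed.

(** The equation is [(7 * c - 72) * (7 * d - 72) = 4687 = 43 * 109]; the smaller factor would lie
    between 47 and 68, where 4687 has no divisor. *)
Lemma two_primes_after5_13_neq (c d : nat) : 17 <= c -> c < d ->
  72 * (c.-1 * d.-1) <> 65 * (c * d) + 1.
Proof.
move=> c17 cd e; have c21 : c < 21.
  rewrite ltnNge; apply/negP=> c21; have := leq_mul c21 (leqnn d).
  have : c.-1 * d.-1 + c + d = c * d + 1.
    by case: c d c17 cd {e c21} => [|c] [|d] //= _ _; ring.
  by lia.
have : c \in iota 17 4 by rewrite mem_iota; lia.
by rewrite !inE; do ![case/orP]; move/eqP=> ec; subst c; lia.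
Qed.

(** Listing the primes in increasing order gives each position its own lower bound. *)
Lemma prod_sorted_primes (s : seq nat) :
  sorted ltn s -> {in s, forall q, prime q} -> 2 \notin s -> 3 \notin s ->
  0 < size s <= 4 ->
  3 * \prod_(q <- s) q.-1 = 2 * \prod_(q <- s) q + 2 ->
  \prod_(q <- s) q \in [:: 5; 5 * 7; 5 * 7 * 37; 5 * 7 * 37 * 1297].
Proof.
move=> srt prm s2 s3 sz.
have gt3 q : q \in s -> [|| q == 5, q == 7, q == 11, q == 13 | 17 <= q].
  move=> qs; have := @prime_gt3_cases q (prm q qs).
  by rewrite !inE !orbA; apply; [apply: contraNneq s2 | apply: contraNneq s3] => <-.
move: srt prm gt3 sz {s2 s3}.
case: s => [|a [|b [|c [|d [|? ?]]]]] //= srt prm gt3 _;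
  rewrite !big_cons !big_nil !muln1.
- by move=> e; have -> : a = 5 by lia.
- move=> e; have := gt3 a; rewrite !inE eqxx => /(_ isT) ha.
  by have [||-> ->] := @two_primes_eq a b _ _ e; [lia | lia | rewrite eqxx orbT].
- move=> e; have := gt3 a; rewrite !inE eqxx => /(_ isT) ha.
  have := gt3 b; rewrite !inE eqxx orbT => /(_ isT) hb.
  have := gt3 c; rewrite !inE eqxx !orbT => /(_ isT) hc.
  (* Otherwise the primes are at least 7, 11, 13, and the left side is too large. *)
  have a5 : a = 5.
    apply/eqP; apply: contraT => na.
    have [a7 b11 c13] : [/\ 7 <= a, 11 <= b & 13 <= c].
      by clear e; split; lia.
    by have := three_primes_smallest _ _ _ a7 b11 c13; rewrite e ltnn.
  subst a.
  by have [|||-> ->] := @two_primes_after5_eq b c; [lia | lia | lia |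
    rewrite !mulnA eqxx !orbT].
- move=> e; have := gt3 a; rewrite !inE eqxx => /(_ isT) ha.
  have := gt3 b; rewrite !inE eqxx orbT => /(_ isT) hb.
  have := gt3 c; rewrite !inE eqxx !orbT => /(_ isT) hc.
  have := gt3 d; rewrite !inE eqxx !orbT => /(_ isT) hd.
  have pc : prime c by apply: prm; rewrite !inE eqxx !orbT.
  have a5 : a = 5.
    apply/eqP; apply: contraT => na.
    have [a7 b11 c13 d14] : [/\ 7 <= a, 11 <= b, 13 <= c & 14 <= d].
      by clear e; split; lia.
    by have := four_primes_smallest _ _ _ _ a7 b11 c13 d14; rewrite e ltnn.
  subst a.
  have b17 : b < 17.
    rewrite ltnNge; apply/negP => b17.
    by have := @three_primes_after5_smallest b c d; lia.
  have /or3P[] : [|| b == 7, b == 11 | b == 13] by lia.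
  + move/eqP=> eb; subst b.
    by have [||||-> ->] := @two_primes_after5_7_eq c d; [lia | lia | done | lia |
      rewrite !mulnA eqxx !orbT].
  (* Here the equation has the form [60 * X = 55 * Y + 1], impossible modulo 5. *)
  + by move/eqP=> eb; subst b; lia.
  + by move/eqP=> eb; subst b; case: (@two_primes_after5_13_neq c d); lia.
Qed.

Lemma prod_predz (s : seq nat) : {in s, forall q, prime q} ->
  (\prod_(q <- s) (q%:Z - 1) = (\prod_(q <- s) q.-1)%N%:Z)%R.
Proof.
move=> prm; rewrite (big_morph Posz PoszM (erefl _)).
by apply: eq_big_seq => q /prm /prime_gt0; lia.
Qed.

(** Lets the witnesses be checked on explicit lists; a permutation carries the products over to the
    finite set. *)
Lemma admissible_seq_fset (s : seq nat) :
  uniq s -> all prime s -> 2 \notin s -> 3 \notin s -> 0 < size s <= 4 ->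
  (3 * \prod_(q <- s) (q%:Z - 1) - 2 * \prod_(q <- s) q%:Z = 2)%R ->
  exists2 Q : {fset nat}, admissible Q & \prod_(q <- s) q = \prod_(q <- Q) q.
Proof.
move=> us /allP ps s2 s3 /andP[s_gt0 s_le4] e.
have pe : perm_eq s (seq_fset tt s).
  by rewrite perm_sym -(undup_id us) uniq_perm ?undup_uniq ?fset_uniq// => x;
     rewrite seq_fsetE !mem_undup.
exists (seq_fset tt s); last exact: perm_big.
split; rewrite ?seq_fsetE //.
- by rewrite -cardfs_gt0 -(perm_size pe).
- by move=> q; rewrite seq_fsetE => /ps.
- by rewrite -(perm_size pe).
- by rewrite -!(perm_big _ pe).
Qed.

Theorem theorem10 :
  (forall (Q : {fset nat}) (n : nat),
     admissible Q -> n = (\prod_(q <- Q) q)%N ->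
     n \in [:: 5; 5 * 7; 5 * 7 * 37; 5 * 7 * 37 * 1297]%N)
  /\
  (forall n : nat,
     n \in [:: 5; 5 * 7; 5 * 7 * 37; 5 * 7 * 37 * 1297]%N ->
     exists2 Q : {fset nat}, admissible Q & n = (\prod_(q <- Q) q)%N).
Proof.
split=> [Q n [Q0 prm [Q2 Q3] Q4 e] -> | n].
  have pe : perm_eq Q (sort leq Q) by rewrite perm_sym perm_sort.
  rewrite (perm_big _ pe); apply: prod_sorted_primes.
  - by rewrite ltn_sorted_uniq_leq sort_uniq fset_uniq sort_sorted//; exact: leq_total.
  - by move=> q; rewrite mem_sort; exact: prm.
  - by rewrite mem_sort.
  - by rewrite mem_sort.
  - by rewrite size_sort Q4 andbT cardfs_gt0.
  - rewrite -!(perm_big _ pe) /=; move: e.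
    rewrite prod_predz // -(big_morph Posz PoszM (erefl _)).
    (* With the products abstracted to [M] and [N], the passage to [nat] is linear. *)
    have int_to_nat (M N : nat) : (3 * M%:Z - 2 * N%:Z = 2)%R -> 3 * M = 2 * N + 2 by lia.
    exact: int_to_nat.
rewrite !inE => /or4P[] /eqP ->.
- have [||||||Q aQ e] := @admissible_seq_fset [:: 5]; rewrite ?big_seq1 //.
  by exists Q; rewrite // -e big_seq1.
- have [||||||Q aQ e] := @admissible_seq_fset [:: 5; 7];
    rewrite ?big_cons ?big_nil //.
  by exists Q; rewrite // -e !big_cons big_nil.
- have [||||||Q aQ e] := @admissible_seq_fset [:: 5; 7; 37];
    rewrite ?big_cons ?big_nil //.
  by exists Q; rewrite // -e !big_cons big_nil muln1 !mulnA.
- have [|Q aQ e] := @admissible_seq_fset [:: 5; 7; 37; 1297] isT isT isT isT isT.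
    by rewrite !big_cons !big_nil; ring.
  by exists Q; rewrite // -e !big_cons big_nil muln1 !mulnA.
Qed.
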